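(* Let $\succsim$ be a binary relation on $l_\infty$. Then $\succsim$ satisfies Weak order, Monotonicity, Continuity, ICRP, Convexity, Monotone continuity and IDIS if and only if there exists a grounded and lower semicontinuous function $c:[0,1]\to[0,\infty]$ with $c(1)=\infty$ such that the function $$I(x)=\min_{\delta\in[0,1)}\Big\{(1-\delta)\sum_{t=0}^{\infty}\delta^t x_t+c(\delta)\Big\}\qquad (x\in l_\infty)$$ is a constant equivalent representing $\succsim$ (with the convention $0^0=1$).
   Context: $l_\infty$ is the space of real bounded sequences $x=(x_0,x_1,\dots)$ indexed by $\mathbb N=\{0,1,2,\dots\}$ with the sup norm. For $\theta\in\mathbb R$, $\theta$ also denotes the constant sequence $(\theta,\theta,\dots)$. $x\ge y$ means $x_n\ge y_n$ for all $n$. A constant equivalent representing $\succsim$ is a function $I:l_\infty\to\mathbb R$ with $x\sim I(x)$ for all $x$ and $x\succsim y$ iff $I(x)\ge I(y)$. For $x,y\in l_\infty$, $A\subseteq\mathbb N$, $xAy$ is the sequence equal to $x_n$ for $n\in A$ and $y_n$ for $n\notin A$; $(E_n)\downarrow\emptyset$ means $E_n\supseteq E_{n+1}$ for all $n$ and $\bigcap_n E_n=\emptyset$. A function $c$ is grounded if $\inf c=0$. Axioms: Weak order: $\succsim$ is complete and transitive. Monotonicity: $x\ge y$ implies $x\succsim y$, and $1\succ 0$. Continuity: whenever $x\succsim y\succsim z$, the sets $\{\alpha\in[0,1]:\alpha x+(1-\alpha)z\succsim y\}$ and $\{\alpha\in[0,1]:y\succsim\alpha x+(1-\alpha)z\}$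 are closed. ICRP: $x\succsim y$ implies $x+\theta\succsim y+\theta$ for all $\theta\in\mathbb R$. Convexity: if $x\succsim\theta$ and $y\succsim\theta$ ($\theta\in\mathbb R$), then $\lambda x+(1-\lambda)y\succsim\theta$ for all $\lambda\in[0,1]$. Monotone continuity: if $x\succ\theta$ ($\theta\in\mathbb R$) and $(E_n)\downarrow\emptyset$, then for every $k\in\mathbb R$ there is $n_0$ with $kE_{n_0}x\succ\theta$. IDIS: for all $x,d\in l_\infty$, $x+d\succsim x$ implies $x+(0,d)\succsim x$, where $(0,d)=(0,d_0,d_1,\dots)$. *)

(* Defs.v *)
From Stdlib Require Import Reals ClassicalEpsilon.
From Coquelicot Require Import Coquelicot.
Open Scope R_scope.

Definition seqR := nat -> R.
Definition in_linf (x : seqR) : Prop := exists M : R, forall t, Rabs (x t) <= M.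

Definition cst (th : R) : seqR := fun _ => th.
Definition sadd (x y : seqR) : seqR := fun t => x t + y t.
Definition smix (a : R) (x y : seqR) : seqR := fun t => a * x t + (1 - a) * y t.
Definition sge (x y : seqR) : Prop := forall t, x t >= y t.
Definition shift0 (d : seqR) : seqR :=
  fun t => match t with O => 0 | S s => d s end.
Definition spaste (x : seqR) (A : nat -> Prop) (y : seqR) : seqR :=
  fun t => if excluded_middle_informative (A t) then x t else y t.

Section Pref.
Variable pref : seqR -> seqR -> Prop.
Definition spref x y := pref x y /\ ~ pref y x.
Definition indiff x y := pref x y /\ pref y x.

Definition WeakOrder : Prop :=
  (forall x y, in_linf x -> in_linf y -> pref x y \/ pref y x) /\
  (forall x y z, in_linf x -> in_linf y -> in_linf z ->
     pref x y -> pref y z -> pref x z).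

Definition Monotonicity : Prop :=
  (forall x y, in_linf x -> in_linf y -> sge x y -> pref x y) /\
  spref (cst 1) (cst 0).

Definition Continuity : Prop :=
  forall x y z, in_linf x -> in_linf y -> in_linf z ->
    pref x y -> pref y z ->
    closed (fun a : R => 0 <= a <= 1 /\ pref (smix a x z) y) /\
    closed (fun a : R => 0 <= a <= 1 /\ pref y (smix a x z)).

Definition ICRP : Prop :=
  forall x y (th : R), in_linf x -> in_linf y ->
    pref x y -> pref (sadd x (cst th)) (sadd y (cst th)).

Definition Convexity : Prop :=
  forall x y (th : R), in_linf x -> in_linf y ->
    pref x (cst th) -> pref y (cst th) ->
    forall l, 0 <= l <= 1 -> pref (smix l x y) (cst th).

Definition MonotoneContinuity : Prop :=
  forall x (th : R) (E : nat -> nat -> Prop), in_linf x ->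
    spref x (cst th) ->
    (forall n t, E (S n) t -> E n t) ->
    (forall t, ~ (forall n, E n t)) ->
    forall k : R, exists n0, spref (spaste (cst k) (E n0) x) (cst th).

Definition IDIS : Prop :=
  forall x d, in_linf x -> in_linf d ->
    pref (sadd x d) x -> pref (sadd x (shift0 d)) x.

Definition ConstEquiv (I : seqR -> R) : Prop :=
  (forall x, in_linf x -> indiff x (cst (I x))) /\
  (forall x y, in_linf x -> in_linf y -> (pref x y <-> I x >= I y)).
End Pref.

(* c : [0,1] -> [0,+oo], only values on [0,1] matter *)
Definition nonneg01 (c : R -> Rbar) : Prop :=
  forall d, 0 <= d <= 1 -> Rbar_le (Finite 0) (c d).
Definition grounded01 (c : R -> Rbar) : Prop :=
  nonneg01 c /\ forall eps, 0 < eps -> exists d, 0 <= d <= 1 /\ Rbar_lt (c d) (Finite eps).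
Definition lsc01 (c : R -> Rbar) : Prop :=
  forall d0, 0 <= d0 <= 1 -> forall a : R, Rbar_lt (Finite a) (c d0) ->
    exists eta, 0 < eta /\
      forall d, 0 <= d <= 1 -> Rabs (d - d0) < eta -> Rbar_lt (Finite a) (c d).

(* objective (1-delta) sum_t delta^t x_t + c(delta); pow 0 0 = 1 *)
Definition objective (c : R -> Rbar) (x : seqR) (d : R) : Rbar :=
  Rbar_plus (Finite ((1 - d) * Series (fun t => d ^ t * x t))) (c d).

Definition is_min_obj (c : R -> Rbar) (x : seqR) (m : R) : Prop :=
  (exists d, 0 <= d < 1 /\ objective c x d = Finite m) /\
  (forall d, 0 <= d < 1 -> Rbar_le (Finite m) (objective c x d)).

(* Main.v *)
(** At a fixed [x], the directions along which [I] strictly increases form an open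
    convex cone, and IDIS says that [shift0] maps this cone into its closure.  A
    Krein-Rutman argument yields a critical rate [r] in [0, 1] such that no
    sequence [r * u - shift0 u] is an ascent direction.  For [r < 1] these
    sequences are exactly those whose [r]-discounted sum vanishes, so geometric
    discounting at rate [r] is a supergradient of [I] at [x], and
    [c d = sup_x (I x - disc d x)] is attained there.  The rate [r = 1] is
    excluded by monotone continuity. *)

Require Import Defs.
From Stdlib Require Import Reals Lra Lia ClassicalEpsilon.
From Coquelicot Require Import Coquelicot.
Open Scope R_scope.

(** * Closure properties of bounded sequences *)

Lemma in_linf_plus (x y : seqR) :
  in_linf x -> in_linf y -> in_linf (fun t => x t + y t).
Proof.
  intros [A HA] [B HB]. exists (A + B). intros t.
  eapply Rle_trans; [apply Rabs_triang|]. apply Rplus_le_compat; auto.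
Qed.

Lemma in_linf_scal (a : R) (x : seqR) :
  in_linf x -> in_linf (fun t => a * x t).
Proof.
  intros [A HA]. exists (Rabs a * A). intros t. rewrite Rabs_mult.
  apply Rmult_le_compat_l; auto using Rabs_pos.
Qed.

Lemma in_linf_minus (x y : seqR) :
  in_linf x -> in_linf y -> in_linf (fun t => x t - y t).
Proof.
  intros [A HA] [B HB]. exists (A + B). intros t.
  specialize (HA t). specialize (HB t). split_Rabs; lra.
Qed.

Lemma in_linf_const (a : R) : in_linf (fun _ => a).
Proof. exists (Rabs a). intros _. lra. Qed.

Lemma in_linf_shift0 (x : seqR) : in_linf x -> in_linf (shift0 x).
Proof.
  intros [A HA]. exists A. intros [|t]; simpl; auto.
  rewrite Rabs_R0. eapply Rle_trans; [apply Rabs_pos | apply (HA O)].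
Qed.

Lemma in_linf_spaste (x y : seqR) (A : nat -> Prop) :
  in_linf x -> in_linf y -> in_linf (spaste x A y).
Proof.
  intros [B HB] [C HC]. exists (Rmax B C). intros t. unfold spaste.
  pose proof (Rmax_l B C). pose proof (Rmax_r B C).
  specialize (HB t). specialize (HC t).
  destruct excluded_middle_informative; lra.
Qed.

Lemma in_linf_bound (x : seqR) :
  in_linf x -> exists B, 0 < B /\ forall t, - B <= x t <= B.
Proof.
  intros [A HA]. exists (Rabs A + 1). split; [pose proof (Rabs_pos A); lra|].
  intros t. specialize (HA t). split_Rabs; lra.
Qed.

#[local] Hint Resolve in_linf_plus in_linf_scal in_linf_minus in_linf_const
  in_linf_shift0 in_linf_spaste : linf.

Ltac linf := unfold sadd, smix, cst in *; auto 12 with linf.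

(** * Normalised geometric discounting *)

(** The finite term of [objective], kept in the same form so that [fold] recovers it. *)
Definition disc (d : R) (x : seqR) : R :=
  (1 - d) * Series (fun t => d ^ t * x t).

Lemma ex_series_disc (d : R) (x : seqR) :
  0 <= d < 1 -> in_linf x -> ex_series (fun t => d ^ t * x t).
Proof.
  intros Hd [A HA].
  apply (@ex_series_le R_AbsRing R_CompleteNormedModule _
           (fun t => A * d ^ t)).
  - intros t. change (Rabs (d ^ t * x t) <= A * d ^ t). rewrite Rabs_mult.
    assert (0 <= d ^ t) by (apply pow_le; lra).
    rewrite (Rabs_pos_eq (d ^ t)) by auto. specialize (HA t). nra.
  - apply (ex_series_scal_l A (fun t => d ^ t)). apply ex_series_geom.
    rewrite Rabs_pos_eq; lra.
Qed.

Lemma disc_ext (d : R) (x y : seqR) :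
  (forall t, x t = y t) -> disc d x = disc d y.
Proof. intros H. unfold disc. f_equal. apply Series_ext. intros t. now rewrite H. Qed.

Lemma disc_plus (d : R) (x y : seqR) :
  0 <= d < 1 -> in_linf x -> in_linf y ->
  disc d (fun t => x t + y t) = disc d x + disc d y.
Proof.
  intros Hd Hx Hy. unfold disc.
  rewrite (Series_ext _ (fun t => d ^ t * x t + d ^ t * y t)) by (intros; ring).
  rewrite Series_plus by (apply ex_series_disc; auto). ring.
Qed.

Lemma disc_scal (d a : R) (x : seqR) :
  disc d (fun t => a * x t) = a * disc d x.
Proof.
  unfold disc.
  rewrite (Series_ext _ (fun t => a * (d ^ t * x t))) by (intros; ring).
  rewrite Series_scal_l. ring.
Qed.

Lemma disc_minus (d : R) (x y : seqR) :
  0 <= d < 1 -> in_linf x -> in_linf y ->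
  disc d (fun t => x t - y t) = disc d x - disc d y.
Proof.
  intros Hd Hx Hy.
  rewrite (disc_ext d _ (fun t => x t + (-1) * y t)) by (intros; ring).
  rewrite disc_plus by linf. rewrite disc_scal. ring.
Qed.

Lemma disc_const (d a : R) : 0 <= d < 1 -> disc d (fun _ => a) = a.
Proof.
  intros Hd. unfold disc.
  rewrite (Series_ext _ (fun t => a * d ^ t)) by (intros; ring).
  rewrite Series_scal_l, Series_geom by (rewrite Rabs_pos_eq; lra). field. lra.
Qed.

Lemma disc_nonneg (d : R) (x : seqR) :
  0 <= d < 1 -> in_linf x -> (forall t, 0 <= x t) -> 0 <= disc d x.
Proof.
  intros Hd Hx H. rewrite <- (disc_const d 0) by auto. unfold disc.
  apply Rmult_le_compat_l; [lra|].
  apply Series_le; [|now apply ex_series_disc].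
  intros t. assert (0 <= d ^ t) by (apply pow_le; lra).
  rewrite Rmult_0_r. split; [lra|]. apply Rmult_le_pos; auto.
Qed.

Lemma disc_le (d : R) (x y : seqR) :
  0 <= d < 1 -> in_linf x -> in_linf y -> (forall t, x t <= y t) ->
  disc d x <= disc d y.
Proof.
  intros Hd Hx Hy H. assert (0 <= disc d (fun t => y t - x t)).
  { apply disc_nonneg; linf. intros t. specialize (H t). lra. }
  rewrite disc_minus in H0 by auto. lra.
Qed.

Lemma disc_shift0 (d : R) (x : seqR) :
  0 <= d < 1 -> in_linf x -> disc d (shift0 x) = d * disc d x.
Proof.
  intros Hd Hx. unfold disc.
  rewrite Series_incr_1 by (apply ex_series_disc; linf). simpl.
  rewrite (Series_ext _ (fun t => d * (d ^ t * x t))) by (intros; simpl; ring).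
  rewrite Series_scal_l. ring.
Qed.

Lemma in_linf_iter_shift0 (n : nat) (x : seqR) :
  in_linf x -> in_linf (Nat.iter n shift0 x).
Proof. intros Hx. induction n; simpl; linf. Qed.

#[local] Hint Resolve in_linf_iter_shift0 : linf.

Lemma disc_iter_shift0 (d : R) (n : nat) (x : seqR) :
  0 <= d < 1 -> in_linf x -> disc d (Nat.iter n shift0 x) = d ^ n * disc d x.
Proof.
  intros Hd Hx. induction n; simpl; [ring|].
  rewrite disc_shift0 by linf. rewrite IHn. ring.
Qed.

Lemma iter_shift0_lt (n : nat) (x : seqR) (t : nat) :
  (t < n)%nat -> Nat.iter n shift0 x t = 0.
Proof.
  revert t. induction n; intros t H; [lia|]. simpl.
  destruct t; simpl; auto. apply IHn. lia.
Qed.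

Lemma iter_shift0_ge (n : nat) (a : R) (t : nat) :
  (n <= t)%nat -> Nat.iter n shift0 (fun _ => a) t = a.
Proof.
  revert t. induction n; intros t H; simpl; auto.
  destruct t; simpl; [lia|]. apply IHn. lia.
Qed.

(** Bounded coefficients give a power series with radius of convergence at least 1. *)
Lemma disc_continuous (x : seqR) (d0 : R) :
  in_linf x -> 0 <= d0 < 1 -> continuous (fun d => disc d x) d0.
Proof.
  intros [A HA] Hd. unfold disc.
  apply (continuous_mult (K := R_AbsRing)).
  - apply (continuous_minus (V := R_NormedModule));
      [apply continuous_const | apply continuous_id].
  - apply continuous_ext with (PSeries x).
    { intros d. apply Series_ext. intros; ring. }
    apply continuity_pt_filterlim, PSeries_continuity.
    apply Rbar_lt_le_trans with (Finite 1); [simpl; rewrite Rabs_pos_eq; lra|].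
    apply (proj1 (CV_radius_bounded x)). exists A. intros t.
    rewrite pow1, Rmult_1_r. apply HA.
Qed.

(** Solving the recursion forward would divide by [r]. Solved backward, [u t] is the [r]-discounted
    sum of the tail of [d] from date [t + 1], bounded by [B / (1 - r)]; the vanishing total settles
    date 0. *)
Lemma ker_disc_range (r : R) (d : seqR) :
  0 <= r < 1 -> in_linf d -> disc r d = 0 ->
  exists u, in_linf u /\ forall t, d t = shift0 u t - r * u t.
Proof.
  intros Hr Hd H0.
  assert (Hs : forall n, in_linf (fun s => d (n + s)%nat)).
  { intros n. destruct Hd as [A HA]. exists A. intros t. apply HA. }
  assert (Hstep : forall n, Series (fun s => r ^ s * d (n + s)%nat)
            = d n + r * Series (fun s => r ^ s * d (S n + s)%nat)).
  { intros n. rewrite Series_incr_1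
      by (apply (ex_series_disc r (fun s => d (n + s)%nat)); auto).
    rewrite Nat.add_0_r, <- Series_scal_l. simpl. rewrite Rmult_1_l. f_equal.
    apply Series_ext. intros s. rewrite Nat.add_succ_r. simpl. ring. }
  exists (fun t => Series (fun s => r ^ s * d (S t + s)%nat)). split.
  - destruct (in_linf_bound d Hd) as [B [HB Hb]]. exists (B / (1 - r)).
    intros t. set (v := Series _).
    assert (Hv : disc r (fun s => d (S t + s)%nat) = (1 - r) * v) by reflexivity.
    assert (disc r (fun s => d (S t + s)%nat) <= B).
    { rewrite <- (disc_const r B) by auto. apply disc_le; linf.
      intros; apply Hb. }
    assert (- B <= disc r (fun s => d (S t + s)%nat)).
    { rewrite <- (disc_const r (- B)) by auto. apply disc_le; linf.
      intros; apply Hb. }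
    assert (B = (1 - r) * (B / (1 - r))) by (field; lra).
    apply Rabs_le. split; nra.
  - intros [|t]; simpl.
    + unfold disc in H0. assert (E : Series (fun t => r ^ t * d t) = 0) by nra.
      pose proof (Hstep O) as E0. simpl in E0. simpl. lra.
    + pose proof (Hstep (S t)) as E. simpl in E. simpl. lra.
Qed.

(** * Concave niveloids and their ascent directions *)

Record concave_niveloid (I : seqR -> R) : Prop := {
  niv_mono : forall x y, in_linf x -> in_linf y ->
    (forall t, x t <= y t) -> I x <= I y;
  niv_const : forall x th, in_linf x -> I (fun t => x t + th) = I x + th;
  niv_concave : forall x y l, in_linf x -> in_linf y -> 0 <= l <= 1 ->
    l * I x + (1 - l) * I y <= I (fun t => l * x t + (1 - l) * y t)
}.

Definition shift_consistent (I : seqR -> R) : Prop :=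
  forall x d, in_linf x -> in_linf d ->
    I x <= I (fun t => x t + d t) -> I x <= I (fun t => x t + shift0 d t).

(** Monotonicity in both directions stands in for functional extensionality. *)
Lemma niv_ext (I : seqR -> R) (x y : seqR) :
  concave_niveloid I -> in_linf x -> in_linf y ->
  (forall t, x t = y t) -> I x = I y.
Proof.
  intros N Hx Hy H.
  apply Rle_antisym; apply (niv_mono I N); auto; intros t; rewrite H; lra.
Qed.

Definition ascent (I : seqR -> R) (x d : seqR) : Prop :=
  in_linf d /\ exists s, 0 < s /\ I x < I (fun t => x t + s * d t).

Section Ascent.
Context (I : seqR -> R) (N : concave_niveloid I) (IS : shift_consistent I)
  (x : seqR) (Hx : in_linf x).

Local Notation Q := (ascent I x).

Lemma ascent_linf (d : seqR) : Q d -> in_linf d.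
Proof. now intros [H _]. Qed.

Hint Resolve ascent_linf : linf.

Lemma ascent_mono (d e : seqR) :
  Q d -> in_linf e -> (forall t, d t <= e t) -> Q e.
Proof.
  intros [Hd [s [Hs H]]] He Hde. split; auto. exists s. split; auto.
  eapply Rlt_le_trans; [apply H|]. apply (niv_mono I N); linf.
  intros t. specialize (Hde t). nra.
Qed.

Lemma ascent_scal (a : R) (d : seqR) : 0 < a -> Q d -> Q (fun t => a * d t).
Proof.
  intros Ha [Hd [s [Hs H]]]. split; linf. exists (s / a).
  split; [now apply Rdiv_lt_0_compat|].
  rewrite (niv_ext I (fun t => x t + s / a * (a * d t))
    (fun t => x t + s * d t) N); linf.
  intros t. field. lra.
Qed.

(** The shorter step is a convex combination of [x] and the longer step, so concavity keeps a share
    [s0 / s] of the gain. Two directions can thus be compared at a common step. *)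
Lemma ascent_small_step (d : seqR) (s s0 : R) :
  in_linf d -> I x < I (fun t => x t + s * d t) -> 0 < s0 <= s ->
  I x < I (fun t => x t + s0 * d t).
Proof.
  intros Hd H Hs.
  assert (Hl : 0 < s0 / s <= 1).
  { split; [apply Rdiv_lt_0_compat; lra|].
    apply (Rmult_le_reg_r s); [lra|]. unfold Rdiv.
    rewrite Rmult_assoc, Rinv_l; lra. }
  pose proof (niv_concave I N (fun t => x t + s * d t) x (s0 / s)
    ltac:(linf) Hx ltac:(lra)) as C.
  rewrite (niv_ext I (fun t => x t + s0 * d t)
    (fun t => s0 / s * (x t + s * d t) + (1 - s0 / s) * x t) N); linf.
  - nra.
  - intros t. field. lra.
Qed.

Lemma ascent_mix (d e : seqR) (l : R) :
  Q d -> Q e -> 0 <= l <= 1 -> Q (fun t => l * d t + (1 - l) * e t).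
Proof.
  intros [Hd [s [Hs H]]] [He [s' [Hs' H']]] Hl. split; linf.
  exists (Rmin s s').
  pose proof (Rmin_l s s'). pose proof (Rmin_r s s').
  pose proof (Rmin_glb_lt s s' 0 Hs Hs').
  set (m := Rmin s s') in *. split; auto.
  pose proof (ascent_small_step d s m Hd H ltac:(lra)).
  pose proof (ascent_small_step e s' m He H' ltac:(lra)).
  pose proof (niv_concave I N (fun t => x t + m * d t) (fun t => x t + m * e t) l
    ltac:(linf) ltac:(linf) Hl) as C.
  rewrite (niv_ext I (fun t => x t + m * (l * d t + (1 - l) * e t))
    (fun t => l * (x t + m * d t) + (1 - l) * (x t + m * e t)) N); linf.
  - destruct (Req_dec l 0) as [->|]; [lra|]. nra.
  - intros t. ring.
Qed.

Lemma ascent_plus (d e : seqR) : Q d -> Q e -> Q (fun t => d t + e t).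
Proof.
  intros Hd He.
  apply (ascent_mono (fun t => 2 * (/ 2 * d t + (1 - / 2) * e t))); linf.
  - apply (ascent_scal 2 (fun t => / 2 * d t + (1 - / 2) * e t)); [lra|].
    apply ascent_mix; auto; lra.
  - intros t. lra.
Qed.

(** Lowering [d] by a constant [eps] lowers the value at step [s] by exactly [s * eps]; the chosen
    [eps] spends half of the gain [g]. *)
Lemma ascent_open (d : seqR) :
  Q d -> exists eps, 0 < eps /\ Q (fun t => d t - eps).
Proof.
  intros [Hd [s [Hs H]]].
  set (g := I (fun t => x t + s * d t) - I x).
  assert (Hg : 0 < g / (2 * s)) by (apply Rdiv_lt_0_compat; unfold g; lra).
  exists (g / (2 * s)). split; auto. split; linf. exists s. split; auto.
  rewrite (niv_ext I (fun t => x t + s * (d t - g / (2 * s)))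
    (fun t => (x t + s * d t) + - (g / 2)) N); linf.
  - rewrite (niv_const I N) by linf. unfold g in *. lra.
  - intros t. field. lra.
Qed.

Lemma ascent_perturb (d : seqR) :
  Q d -> exists eps, 0 < eps /\
    forall e, in_linf e -> (forall t, d t - eps <= e t) -> Q e.
Proof.
  intros H. destruct (ascent_open d H) as [eps [He Hq]].
  exists eps. split; auto. intros e Hle Hde.
  now apply (ascent_mono (fun t => d t - eps)).
Qed.

Lemma ascent_const (a : R) : 0 < a -> Q (fun _ => a).
Proof.
  intros Ha. split; linf. exists 1. split; [lra|].
  rewrite (niv_const I N x) by auto. lra.
Qed.

Lemma not_ascent_nonpos (d : seqR) : (forall t, d t <= 0) -> ~ Q d.
Proof.
  intros H [Hd [s [Hs Hlt]]].
  assert (I (fun t => x t + s * d t) <= I x).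
  { apply (niv_mono I N); linf. intros t. specialize (H t). nra. }
  lra.
Qed.

(** * The shift on the ascent cone and its critical rate *)

Lemma ascent_shift0 (d : seqR) (eps : R) :
  Q d -> 0 < eps -> Q (fun t => shift0 d t + eps).
Proof.
  intros [Hd [s [Hs H]]] He. split; linf. exists s. split; auto.
  (* Shift consistency yields only a weak inequality; the constant [eps] makes it strict. *)
  assert (H1 := IS x (fun t => s * d t) Hx ltac:(linf) ltac:(lra)).
  rewrite (niv_ext I (fun t => x t + s * (shift0 d t + eps))
    (fun t => (x t + shift0 (fun u => s * d u) t) + s * eps) N); linf.
  - rewrite (niv_const I N) by linf. nra.
  - intros [|t]; simpl; ring.
Qed.

(** Continuation along the segment from [d] to [u]: the parameters whose point lies in the cone
    include 0, and their supremum [l] belongs to them and can be exceeded unless it is 1. One [d]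
    thus suffices for the resolvent of the shift at [mu] to preserve the cone. *)
Lemma ascent_resolvent (mu : R) (d u : seqR) :
  0 < mu -> Q d -> Q (fun t => mu * d t - shift0 d t) ->
  in_linf u -> Q (fun t => mu * u t - shift0 u t) -> Q u.
Proof.
  intros Hmu Hd HRd Hu HRu.
  assert (Ld := ascent_linf d Hd).
  set (E := fun l => 0 <= l <= 1 /\ Q (fun t => l * u t + (1 - l) * d t)).
  assert (E0 : E 0).
  { split; [lra|]. apply (ascent_mono d); linf. intros; lra. }
  destruct (completeness E) as [l [Hub Hlub]].
  { exists 1. intros l [Hl _]. lra. }
  { now exists 0. }
  assert (Hl : 0 <= l <= 1).
  { split; [now apply Hub|]. apply Hlub. intros a [Ha _]. lra. }
  destruct (in_linf_bound u Hu) as [B [HB Hb]].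
  destruct (in_linf_bound d Ld) as [C [HC Hc]].
  set (v := fun t => l * u t + (1 - l) * d t).
  assert (Lv : in_linf v) by (unfold v; linf).
  assert (Hclose : forall a t, Rabs (a - l) * (B + C) >=
            Rabs ((a * u t + (1 - a) * d t) - v t)).
  { intros a t. unfold v.
    replace (a * u t + (1 - a) * d t - (l * u t + (1 - l) * d t))
      with ((a - l) * (u t - d t)) by ring.
    rewrite Rabs_mult. apply Rle_ge, Rmult_le_compat_l; [apply Rabs_pos|].
    specialize (Hb t). specialize (Hc t). split_Rabs; lra. }
  (* The point [v] at the supremum is so far known only to lie in the closure of the cone. *)
  assert (Pv : forall eps, 0 < eps -> Q (fun t => v t + eps)).
  { intros eps He.
    assert (0 < eps / (B + C)) by (apply Rdiv_lt_0_compat; lra).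
    assert (exists a, E a /\ l - eps / (B + C) < a) as [a [Ha Hla]].
    { apply NNPP. intros Hn. assert (l <= l - eps / (B + C)); [|lra].
      apply Hlub. intros a Ha. apply Rnot_lt_le. intros Hlt. apply Hn. eauto. }
    apply (ascent_mono _ _ (proj2 Ha)); linf.
    intros t. specialize (Hclose a t). pose proof (Hub a Ha).
    assert (Rabs (a - l) * (B + C) <= eps).
    { replace eps with (eps / (B + C) * (B + C)) by (field; lra).
      apply Rmult_le_compat_r; [lra|]. split_Rabs; lra. }
    split_Rabs; lra. }
  assert (HRv : Q (fun t => mu * v t - shift0 v t)).
  { eapply ascent_mono; [apply (ascent_mix _ _ l HRu HRd Hl)|linf|].
    intros [|t]; unfold v; simpl; lra. }
  (* Here [mu * v] is the sum of [mu * v - shift0 v], interior to the cone, and [shift0 v], in its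
     closure. The slack [eps] of the first pays for the two halves used to approximate the
     second. *)
  assert (Qv : Q v).
  { destruct (ascent_open _ HRv) as [eps [He HQ]].
    assert (H1 := ascent_shift0 (fun t => v t + eps / 2) (eps / 2)
                    (Pv (eps / 2) ltac:(lra)) ltac:(lra)).
    assert (H2 := ascent_scal (/ mu) _ (Rinv_0_lt_compat _ Hmu)
                    (ascent_plus _ _ HQ H1)).
    apply (ascent_mono _ _ H2); auto. intros t.
    apply (Rmult_le_reg_l mu); auto. rewrite <- Rmult_assoc, Rinv_r by lra.
    destruct t; simpl; lra. }
  destruct (Req_dec l 1) as [E1|Hl1].
  { apply (ascent_mono v); auto. intros t. unfold v. rewrite E1. lra. }
  destruct (ascent_perturb v Qv) as [eps [He Hpert]].
  (* A step past [l] that stays in [0, 1] and moves the point by at most [eps] at every date. *)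
  set (h := Rmin (1 - l) (eps / (B + C))).
  assert (Hh : 0 < h).
  { apply Rmin_glb_lt; [lra|]. apply Rdiv_lt_0_compat; lra. }
  assert (Hh1 := Rmin_l _ _ : h <= 1 - l).
  assert (Hh2 := Rmin_r _ _ : h <= eps / (B + C)).
  assert (l + h <= l); [|lra].
  apply Hub. split; [lra|]. apply Hpert; linf. intros t.
  specialize (Hclose (l + h) t). replace (l + h - l) with h in Hclose by ring.
  rewrite (Rabs_pos_eq h) in Hclose by lra.
  assert (h * (B + C) <= eps).
  { replace eps with (eps / (B + C) * (B + C)) by (field; lra).
    apply Rmult_le_compat_r; lra. }
  split_Rabs; lra.
Qed.

(* The infimum of this set plays the role of the Perron-Frobenius eigenvalue of
   the adjoint of [shift0] acting on the polar cone of the ascent directions. *)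
Definition super_eigen (mu : R) : Prop :=
  exists d, Q d /\ Q (fun t => mu * d t - shift0 d t).

Lemma super_eigen_gt1 (mu : R) : 1 < mu -> super_eigen mu.
Proof.
  intros H. exists (fun _ => 1). split; [apply ascent_const; lra|].
  apply (ascent_mono (fun _ => mu - 1)); linf; [apply ascent_const; lra|].
  intros [|t]; simpl; lra.
Qed.

(** Adding the shift of [d], which lies in the closure of the cone, to [mu * d - shift0 d] puts
    [mu * d] in the cone. For [mu <= 0], adding [- mu] times [d] would put the zero sequence
    there. *)
Lemma super_eigen_pos (mu : R) : super_eigen mu -> 0 < mu.
Proof.
  intros [d [Hd H]]. apply Rnot_le_lt. intros Hmu.
  destruct (ascent_open _ H) as [eps [He H1]].
  assert (H2 := ascent_plus _ _ H1 (ascent_shift0 d eps Hd He)).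
  destruct (Req_dec mu 0) as [->|Hne].
  - refine (not_ascent_nonpos _ _ H2). intros t. lra.
  - refine (not_ascent_nonpos _ _
      (ascent_plus _ _ H2 (ascent_scal (- mu) d ltac:(lra) Hd))).
    intros t. lra.
Qed.

Lemma resolvent_open (mu : R) (d : seqR) :
  in_linf d -> Q (fun t => mu * d t - shift0 d t) ->
  exists eta, 0 < eta /\ forall nu, Rabs (nu - mu) < eta ->
    Q (fun t => nu * d t - shift0 d t).
Proof.
  intros Hd H. destruct (ascent_perturb _ H) as [eps [He Hp]].
  destruct (in_linf_bound d Hd) as [B [HB Hb]].
  exists (eps / B). split; [now apply Rdiv_lt_0_compat|].
  intros nu Hnu. apply Hp; linf. intros t.
  assert (Rabs ((nu - mu) * d t) <= eps).
  { rewrite Rabs_mult. replace eps with (eps / B * B) by (field; lra).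
    apply Rmult_le_compat; try apply Rabs_pos; [lra|].
    specialize (Hb t). split_Rabs; lra. }
  split_Rabs; lra.
Qed.

(** The rate [r] is the infimum of the super-eigenvalues. If [r * u - shift0 u] were an ascent
    direction, so would be [mu * u - shift0 u] for all [mu] near [r]. A super-eigenvalue that close
    to [r] puts [u] in the cone by the resolvent lemma, and then [u] witnesses a super-eigenvalue
    below [r]. *)
Lemma critical_rate :
  exists r, 0 <= r <= 1 /\
    forall u, in_linf u -> ~ Q (fun t => r * u t - shift0 u t).
Proof.
  (* [completeness] provides suprema, so signs are reversed: [m] is minus the critical rate. *)
  destruct (completeness (fun a => super_eigen (- a))) as [m [Hub Hlub]].
  { exists 0. intros a Ha. apply super_eigen_pos in Ha. lra. }
  { exists (-2). apply super_eigen_gt1. lra. }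
  exists (- m). split.
  - split.
    + assert (m <= 0); [|lra]. apply Hlub. intros a Ha.
      apply super_eigen_pos in Ha. lra.
    + apply Rnot_lt_le. intros H.
      (* The midpoint of 1 and [- m] would be a super-eigenvalue below the infimum. *)
      assert (- ((1 - m) / 2) <= m); [|lra].
      apply Hub. apply super_eigen_gt1. lra.
  - intros u Hu H.
    destruct (resolvent_open _ u Hu H) as [eta [Heta Ho]].
    assert (exists a, super_eigen (- a) /\ m - eta < a) as [a [[d [Hd HRd]] Ha]].
    { apply NNPP. intros Hn. assert (m <= m - eta); [|lra].
      apply Hlub. intros a Ha. apply Rnot_lt_le. intros Hlt. apply Hn. eauto. }
    assert (Hm : a <= m) by (apply Hub; now exists d).
    assert (Ha0 : 0 < - a) by (apply super_eigen_pos; now exists d).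
    assert (Qu : Q u).
    { apply (ascent_resolvent (- a) d u); auto. apply Ho. split_Rabs; lra. }
    assert (m + eta / 2 <= m); [|lra].
    apply Hub. exists u. split; auto. apply Ho. split_Rabs; lra.
Qed.

End Ascent.

(** * Geometric supergradients and the variational formula *)

(** Monotone continuity for the tails of the time axis, expressed through [I]. *)
Definition tail_continuous (I : seqR -> R) : Prop :=
  forall x th k, in_linf x -> th < I x ->
    exists n, th < I (spaste (fun _ => k) (fun t => (n <= t)%nat) x).

Lemma geometric_supergradient (I : seqR -> R) (x : seqR) :
  concave_niveloid I -> shift_consistent I -> tail_continuous I -> in_linf x ->
  exists d, 0 <= d < 1 /\
    forall y, in_linf y -> I y - disc d y <= I x - disc d x.
Proof.
  intros N IS TC Hx.
  destruct (critical_rate I N IS x Hx) as [r [Hr Hcrit]].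
  destruct (Req_dec r 1) as [->|Hne].
  - exfalso. destruct (in_linf_bound x Hx) as [B [HB Hb]].
    destruct (TC (fun t => x t + 1) (I x) (- B)) as [n Hn]; [linf| |].
    { rewrite (niv_const I N) by auto. lra. }
    (* A ramp: [u + 1] minus its shift is 1 up to date [n] and 0 afterwards, the added 1 covering
       date 0. Moving [x] in this direction dominates the sequence from tail continuity, so it is an
       ascent direction. *)
    set (u := fun t => INR (Nat.min t n)).
    assert (Hu : in_linf u).
    { exists (INR n). intros t. unfold u. rewrite Rabs_pos_eq by apply pos_INR.
      apply le_INR. lia. }
    apply (Hcrit (fun t => u t + 1)); linf. split; linf.
    exists 1. split; [lra|]. eapply Rlt_le_trans; [apply Hn|].
    apply (niv_mono I N); linf. intros t. unfold spaste.
    specialize (Hb t).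
    destruct excluded_middle_informative as [Ht|Ht];
      destruct t as [|t]; unfold u; simpl shift0.
    + assert (n = 0)%nat as -> by lia. simpl. lra.
    + assert (INR (Nat.min t n) <= INR (Nat.min (S t) n)) by (apply le_INR; lia).
      lra.
    + simpl. lra.
    + rewrite !Nat.min_l by lia. rewrite S_INR. lra.
  - exists r. split; [lra|]. intros y Hy.
    set (a := disc r (fun t => y t - x t)).
    assert (Ha : a = disc r y - disc r x) by (apply disc_minus; auto; lra).
    (* Centred by its discounted value [a], the move from [x] to [y] equals [r * w - shift0 w] with
       [w = - u]. A violated supergradient inequality would make it an ascent direction with step
       1. *)
    destruct (ker_disc_range r (fun t => (y t - x t) - a)) as [u [Hu Heq]].
    { lra. }
    { linf. }
    { rewrite disc_minus by (auto with linf; lra).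
      rewrite disc_const by lra. unfold a. ring. }
    apply Rnot_lt_le. intros Hlt.
    apply (Hcrit (fun t => (-1) * u t)); linf. split; linf.
    exists 1. split; [lra|].
    rewrite (niv_ext I (fun t => x t + 1 * (r * (-1 * u t) - shift0 (fun v => -1 * u v) t))
      (fun t => y t + - a) N); linf.
    + rewrite (niv_const I N) by auto. lra.
    + intros t. specialize (Heq t). destruct t; simpl in *; lra.
Qed.

(** The cost is the conjugate of [I] restricted to geometric weights, set to infinity from rate 1
    on. The zero sequence gives nonnegativity, the supergradient at zero gives groundedness, and the
    supergradient at [x] attains the minimum. *)
Lemma variational_representation (I : seqR -> R) :
  concave_niveloid I -> shift_consistent I -> tail_continuous I ->
  I (cst 0) = 0 ->
  exists c, grounded01 c /\ lsc01 c /\ c 1 = p_infty /\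
    forall x, in_linf x -> is_min_obj c x (I x).
Proof.
  intros N IS TC I0.
  set (V := fun d v => exists x, in_linf x /\ v = I x - disc d x).
  set (c := fun d => if Rlt_dec d 1 then Lub_Rbar (V d) else p_infty).
  assert (c_lub : forall d, d < 1 -> is_lub_Rbar (V d) (c d)).
  { intros d Hd. unfold c. destruct Rlt_dec; [apply Lub_Rbar_correct|easy]. }
  assert (c_lb : forall d x, d < 1 -> in_linf x ->
            Rbar_le (Finite (I x - disc d x)) (c d)).
  { intros d x Hd Hx. apply (proj1 (c_lub d Hd)). now exists x. }
  assert (c_ge1 : forall d, ~ d < 1 -> c d = p_infty).
  { intros d Hd. unfold c. now destruct Rlt_dec. }
  assert (c_eq : forall d x, d < 1 -> in_linf x ->
            (forall y, in_linf y -> I y - disc d y <= I x - disc d x) ->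
            c d = Finite (I x - disc d x)).
  { intros d x Hd Hx H. apply Rbar_le_antisym; [|now apply c_lb].
    apply (proj2 (c_lub d Hd)). intros v [y [Hy ->]]. now apply H. }
  exists c. split; [split|split; [|split]].
  - intros d Hd. destruct (Rlt_dec d 1) as [H|H]; [|now rewrite c_ge1].
    replace 0 with (I (cst 0) - disc d (cst 0)); [apply c_lb; linf|].
    rewrite I0. unfold cst. rewrite disc_const; lra.
  - intros eps He.
    destruct (geometric_supergradient I (cst 0) N IS TC ltac:(linf))
      as [d [Hd H]].
    exists d. split; [lra|]. rewrite (c_eq d (cst 0)) by (auto; lra || linf).
    rewrite I0. unfold cst. rewrite disc_const by auto. simpl. lra.
  - intros d0 Hd0 a Ha. destruct (Rlt_dec d0 1) as [H|H].
    + assert (exists x, in_linf x /\ a < I x - disc d0 x) as [x [Hx Hax]].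
      { apply NNPP. intros Hn. apply (Rbar_lt_not_le _ _ Ha).
        apply (proj2 (c_lub d0 H)). intros v [x [Hx ->]]. simpl.
        apply Rnot_lt_le. intros Hlt. apply Hn. eauto. }
      assert (Hc := disc_continuous x d0 Hx ltac:(lra)).
      assert (Hp : 0 < I x - disc d0 x - a) by lra.
      destruct (proj1 (filterlim_locally _ _) Hc (mkposreal _ Hp)) as [eta He].
      exists eta. split; [apply cond_pos|]. intros d Hd Hdd.
      destruct (Rlt_dec d 1) as [H1|H1]; [|now rewrite c_ge1].
      apply Rbar_lt_le_trans with (Finite (I x - disc d x)); [|now apply c_lb].
      specialize (He d Hdd). change (Rabs (disc d x - disc d0 x) <
        I x - disc d0 x - a) in He. simpl. split_Rabs; lra.
    + assert (d0 = 1) as -> by lra.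
      (* Tail continuity at zero gives [y], equal to [- k] from date [n] on, with [I y > -1]. Once
         [d ^ n > / 2], its discounted value is below [- k / 2], so the cost exceeds
         [k / 2 - 1 >= a]. *)
      set (k := 2 * (Rabs a + 1)).
      assert (Hk : a + 1 <= k / 2).
      { unfold k. pose proof (Rle_abs a). lra. }
      assert (Hk0 : 0 < k) by (unfold k; pose proof (Rabs_pos a); lra).
      destruct (TC (cst 0) (-1) (- k)) as [n Hn]; [linf|lra|].
      set (y := Nat.iter n shift0 (fun _ => - k)).
      assert (Hy : in_linf y) by (unfold y; linf).
      assert (HIy : -1 < I y).
      { eapply Rlt_le_trans; [apply Hn|]. apply (niv_mono I N); linf.
        intros t. unfold spaste, y.
        destruct excluded_middle_informative as [Ht|Ht].
        - rewrite iter_shift0_ge by auto. lra.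
        - rewrite iter_shift0_lt by lia. lra. }
      assert (Hc : continuous (fun d => d ^ n) 1).
      { apply continuity_pt_filterlim, derivable_continuous_pt,
          derivable_pt_pow. }
      destruct (proj1 (filterlim_locally _ _) Hc (mkposreal (/ 2) ltac:(lra)))
        as [eta He].
      exists eta. split; [apply cond_pos|]. intros d Hd Hdd.
      destruct (Rlt_dec d 1) as [H1|H1]; [|now rewrite c_ge1].
      apply Rbar_lt_le_trans with (Finite (I y - disc d y)); [|now apply c_lb].
      specialize (He d Hdd). change (Rabs (d ^ n - 1 ^ n) < / 2) in He.
      rewrite pow1 in He. unfold y at 2.
      rewrite disc_iter_shift0, disc_const by (auto with linf; lra).
      assert (/ 2 < d ^ n) by (split_Rabs; lra). simpl. nra.
  - apply c_ge1. lra.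
  - intros x Hx.
    destruct (geometric_supergradient I x N IS TC Hx) as [r [Hr H]]. split.
    + exists r. split; auto. unfold objective. fold (disc r x).
      rewrite (c_eq r x) by (auto; lra). simpl. f_equal. ring.
    + intros d Hd. unfold objective. fold (disc d x).
      assert (Hc := c_lb d x ltac:(lra) Hx).
      destruct (c d); simpl in *; [lra|easy|easy].
Qed.

(** * From a cost function to the axioms *)

Lemma is_min_obj_attained (c : R -> Rbar) (x : seqR) (m : R) :
  is_min_obj c x m -> exists d v, 0 <= d < 1 /\ c d = Finite v /\ m = disc d x + v.
Proof.
  intros [[d [Hd H]] _]. unfold objective in H. fold (disc d x) in H.
  destruct (c d) as [v| |] eqn:E; try easy. exists d, v.
  repeat split; auto; try lra. now injection H.
Qed.

Lemma is_min_obj_le (c : R -> Rbar) (x : seqR) (m d v : R) :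
  is_min_obj c x m -> 0 <= d < 1 -> c d = Finite v -> m <= disc d x + v.
Proof.
  intros [_ H] Hd E. specialize (H d Hd). unfold objective in H.
  fold (disc d x) in H. rewrite E in H. exact H.
Qed.

Section FromCost.
Context (c : R -> Rbar) (I : seqR -> R)
  (Hmin : forall x, in_linf x -> is_min_obj c x (I x)).

(** A minimum of monotone affine functions that commute with adding constants. Each inequality
    evaluates the smaller side at its minimiser and uses that rate as a competitor on the other. *)
Lemma cost_niveloid : concave_niveloid I.
Proof.
  split.
  - intros x y Hx Hy H.
    destruct (is_min_obj_attained _ _ _ (Hmin y Hy)) as [d [v [Hd [E ->]]]].
    pose proof (is_min_obj_le _ _ _ _ _ (Hmin x Hx) Hd E).
    pose proof (disc_le d x y Hd Hx Hy H). lra.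
  - intros x th Hx.
    assert (Hy : in_linf (fun t => x t + th)) by linf.
    assert (D : forall d, 0 <= d < 1 ->
              disc d (fun t => x t + th) = disc d x + th).
    { intros d Hd. rewrite disc_plus, disc_const by linf. ring. }
    destruct (is_min_obj_attained _ _ _ (Hmin x Hx)) as [d [v [Hd [E E1]]]].
    destruct (is_min_obj_attained _ _ _ (Hmin _ Hy)) as [d' [v' [Hd' [E' E1']]]].
    pose proof (is_min_obj_le _ _ _ _ _ (Hmin _ Hy) Hd E).
    pose proof (is_min_obj_le _ _ _ _ _ (Hmin _ Hx) Hd' E').
    rewrite D in * by auto. lra.
  - intros x y l Hx Hy Hl.
    assert (Hz : in_linf (fun t => l * x t + (1 - l) * y t)) by linf.
    destruct (is_min_obj_attained _ _ _ (Hmin _ Hz)) as [d [v [Hd [E ->]]]].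
    rewrite disc_plus, !disc_scal by linf.
    pose proof (is_min_obj_le _ _ _ _ _ (Hmin _ Hx) Hd E).
    pose proof (is_min_obj_le _ _ _ _ _ (Hmin _ Hy) Hd E). nra.
Qed.

Lemma cost_shift_consistent : shift_consistent I.
Proof.
  intros x e Hx He H.
  assert (H1 : in_linf (fun t => x t + e t)) by linf.
  assert (H2 : in_linf (fun t => x t + shift0 e t)) by linf.
  destruct (is_min_obj_attained _ _ _ (Hmin _ H2)) as [d [v [Hd [E ->]]]].
  rewrite disc_plus, disc_shift0 by linf.
  pose proof (is_min_obj_le _ _ _ _ _ (Hmin _ Hx) Hd E).
  pose proof (is_min_obj_le _ _ _ _ _ (Hmin _ H1) Hd E) as H3.
  rewrite disc_plus in H3 by linf.
  (* At the minimiser [d] for the shifted sum, [d * disc d e] is at least 0 or at least [disc d e],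
     according to the sign; compare with [I] at [x] or at [x + e]. *)
  destruct (Rle_dec 0 (disc d e)); nra.
Qed.

(** The infinite cost at 1 and lower semicontinuity keep the minimising rates of all pasted
    sequences below one bound [b < 1], so the weight of the tail vanishes uniformly as [n] grows. *)
Lemma cost_tail_continuous :
  lsc01 c -> c 1 = p_infty -> I (cst 0) = 0 -> tail_continuous I.
Proof.
  intros L c1 I0 x th k Hx Hth.
  pose proof cost_niveloid as N.
  destruct (in_linf_bound x Hx) as [B [HB Hb]].
  set (K := B + Rabs k). pose proof (Rabs_pos k).
  (* A pasted sequence has [I y <= K] and discounted value at least [- K], so the cost at its
     minimiser is at most [2 * K]. *)
  destruct (L 1 ltac:(lra) (2 * K) ltac:(now rewrite c1)) as [eta [He Hc]].
  set (b := Rmax 0 (1 - eta)).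
  assert (Hb0 : 0 <= b < 1).
  { unfold b. split; [apply Rmax_l|]. apply Rmax_lub_lt; lra. }
  assert (Hq : 0 < (I x - th) / (2 * K)) by (apply Rdiv_lt_0_compat; unfold K; lra).
  destruct (pow_lt_1_zero b ltac:(rewrite Rabs_pos_eq; lra) _ Hq) as [n Hn].
  specialize (Hn n ltac:(lia)). exists n.
  set (y := spaste (fun _ => k) (fun t => (n <= t)%nat) x).
  assert (Hy : in_linf y) by (unfold y; linf).
  assert (Hyb : forall t, - K <= y t <= K).
  { intros t. unfold y, spaste, K. specialize (Hb t).
    destruct excluded_middle_informative; split_Rabs; lra. }
  assert (HIy : I y <= K).
  { rewrite <- (Rplus_0_l K), <- I0, <- (niv_const I N (cst 0)) by linf.
    apply (niv_mono I N); linf. intros t. specialize (Hyb t). lra. }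
  destruct (is_min_obj_attained _ _ _ (Hmin y Hy)) as [d [v [Hd [E Hyv]]]].
  assert (- K <= disc d y).
  { rewrite <- (disc_const d (- K)) by auto. apply disc_le; linf.
    intros t. apply Hyb. }
  assert (Hdb : d <= b).
  { apply Rle_trans with (1 - eta); [|apply Rmax_r]. apply Rnot_lt_le.
    intros Hlt. assert (Hv : Rbar_lt (Finite (2 * K)) (c d)).
    { apply Hc; [lra|]. split_Rabs; lra. }
    rewrite E in Hv. simpl in Hv. lra. }
  pose proof (is_min_obj_le _ _ _ _ _ (Hmin x Hx) Hd E).
  assert (Hxy : disc d x <= disc d (fun t => y t + Nat.iter n shift0 (fun _ => 2 * K) t)).
  { apply disc_le; linf. intros t. specialize (Hyb t). specialize (Hb t).
    unfold y, spaste in *.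
    destruct excluded_middle_informative as [Ht|Ht].
    - rewrite iter_shift0_ge by auto. unfold K in *. lra.
    - rewrite iter_shift0_lt by lia. lra. }
  rewrite disc_plus, disc_iter_shift0, disc_const in Hxy by linf.
  assert (d ^ n <= b ^ n) by (apply pow_incr; lra).
  assert (d ^ n * (2 * K) < I x - th); [|lra].
  rewrite Rabs_pos_eq in Hn by (apply pow_le; lra).
  replace (I x - th) with ((I x - th) / (2 * K) * (2 * K))
    by (field; unfold K; lra).
  apply Rmult_lt_compat_r; unfold K in *; lra.
Qed.

End FromCost.

(** Monotonicity and translation make the map Lipschitz with constant [B + C]. *)
Lemma niv_mix_continuous (I : seqR -> R) (x z : seqR) (a : R) :
  concave_niveloid I -> in_linf x -> in_linf z ->
  continuous (fun a => I (smix a x z)) a.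
Proof.
  intros N Hx Hz.
  destruct (in_linf_bound x Hx) as [B [HB Hb]].
  destruct (in_linf_bound z Hz) as [C [HC Hc]].
  assert (Lip : forall a b, I (smix a x z) <= I (smix b x z) + Rabs (a - b) * (B + C)).
  { intros u w. rewrite <- (niv_const I N) by linf.
    apply (niv_mono I N); linf. intros t.
    assert (Rabs ((u - w) * (x t - z t)) <= Rabs (u - w) * (B + C)).
    { rewrite Rabs_mult. apply Rmult_le_compat_l; [apply Rabs_pos|].
      specialize (Hb t). specialize (Hc t). split_Rabs; lra. }
    pose proof (Rle_abs ((u - w) * (x t - z t))). lra. }
  apply filterlim_locally. intros eps.
  assert (Hp : 0 < eps / (B + C)) by (apply Rdiv_lt_0_compat; [apply cond_pos|lra]).
  exists (mkposreal _ Hp). intros b Hab.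
  change (Rabs (b - a) < eps / (B + C)) in Hab.
  change (Rabs (I (smix b x z) - I (smix a x z)) < eps).
  pose proof (Lip a b) as L1. rewrite Rabs_minus_sym in L1. pose proof (Lip b a).
  assert (Rabs (b - a) * (B + C) < eps).
  { replace (pos eps) with (eps / (B + C) * (B + C)) by (field; lra).
    apply Rmult_lt_compat_r; lra. }
  apply Rabs_def1; lra.
Qed.

Lemma vanishing_initial (E : nat -> nat -> Prop) :
  (forall n t, E (S n) t -> E n t) -> (forall t, ~ (forall n, E n t)) ->
  forall T, exists n, forall t, (t < T)%nat -> ~ E n t.
Proof.
  intros Hdec Hemp.
  assert (Hm : forall n m t, (n <= m)%nat -> E m t -> E n t).
  { intros n m t Hnm. induction Hnm; auto. }
  induction T as [|T [n Hn]].
  - exists O. lia.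
  - destruct (not_all_ex_not _ _ (Hemp T)) as [m Hm0].
    exists (n + m)%nat. intros t Ht HE. destruct (Nat.eq_dec t T) as [->|Hne].
    + apply Hm0. apply (Hm m (n + m)%nat); auto. lia.
    + apply (Hn t); [lia|]. apply (Hm n (n + m)%nat); auto. lia.
Qed.

Lemma cost_axioms (pref : seqR -> seqR -> Prop) (c : R -> Rbar) (I : seqR -> R) :
  lsc01 c -> c 1 = p_infty ->
  (forall x, in_linf x -> is_min_obj c x (I x)) -> ConstEquiv pref I ->
  WeakOrder pref /\ Monotonicity pref /\ Continuity pref /\ ICRP pref /\
  Convexity pref /\ MonotoneContinuity pref /\ IDIS pref.
Proof.
  intros L c1 Hmin [Hce Hrep].
  pose proof (cost_niveloid c I Hmin) as N.
  assert (Lc : forall a, in_linf (cst a)) by (intros; linf).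
  (* Translation gives [I (cst (I (cst 0))) = 2 * I (cst 0)], while indifference gives
     [I (cst 0)]. *)
  assert (I0 : I (cst 0) = 0).
  { assert (I (cst (0 + I (cst 0))) = I (cst 0) + I (cst 0))
      by exact (niv_const I N (cst 0) (I (cst 0)) (Lc 0)).
    rewrite Rplus_0_l in H.
    destruct (Hce (cst 0) (Lc 0)) as [H1 H2].
    apply Hrep in H1; auto. apply Hrep in H2; auto. lra. }
  assert (Ic : forall a, I (cst a) = a).
  { intros a. rewrite <- (Rplus_0_l a) at 1.
    transitivity (I (cst 0) + a); [exact (niv_const I N (cst 0) a (Lc 0))|lra]. }
  pose proof (cost_tail_continuous c I Hmin L c1 I0) as TC.
  assert (Hs : forall x a, in_linf x -> (spref pref x (cst a) <-> a < I x)).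
  { intros x a Hx. unfold spref. rewrite !Hrep, Ic by linf. lra. }
  split; [|split; [|split; [|split; [|split; [|split]]]]].
  - split.
    + intros x y Hx Hy. rewrite !Hrep by auto. lra.
    + intros x y z Hx Hy Hz. rewrite !Hrep by auto. lra.
  - split.
    + intros x y Hx Hy H. apply Hrep; auto. apply Rle_ge, (niv_mono I N); auto.
      intros t. apply Rge_le, H.
    + apply Hs; auto. rewrite Ic. lra.
  - intros x y z Hx Hy Hz _ _.
    assert (Lm : forall a, in_linf (smix a x z)) by (intros; linf).
    assert (H01 : closed (fun a => 0 <= a <= 1)).
    { apply closed_and; [apply closed_ge|apply closed_le]. }
    split; apply closed_and; auto.
    + apply closed_ext with (fun a => I y <= I (smix a x z)).
      { intros a. rewrite Hrep by auto. lra. }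
      apply (closed_comp (fun a => I (smix a x z)) (fun v => I y <= v));
        [|apply closed_ge]. intros a. now apply niv_mix_continuous.
    + apply closed_ext with (fun a => I (smix a x z) <= I y).
      { intros a. rewrite Hrep by auto. lra. }
      apply (closed_comp (fun a => I (smix a x z)) (fun v => v <= I y));
        [|apply closed_le]. intros a. now apply niv_mix_continuous.
  - intros x y th Hx Hy H. apply Hrep in H; auto. apply Hrep; try now linf.
    unfold sadd, cst. rewrite !(niv_const I N) by auto. lra.
  - intros x y th Hx Hy H1 H2 l Hl.
    apply Hrep in H1; auto. apply Hrep in H2; auto. apply Hrep; try now linf.
    rewrite Ic in *.
    pose proof (niv_concave I N x y l Hx Hy Hl).
    change (I (smix l x y) >= th). unfold smix. nra.
  - intros x th E Hx H Hdec Hemp k. apply Hs in H; auto.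
    destruct (in_linf_bound x Hx) as [B [HB Hb]].
    (* This constant lies below both [k] and [x], so pasting it from [T] on is dominated by pasting
       [k] on any set that avoids the dates before [T]. *)
    destruct (TC x th (- (B + Rabs k)) Hx H) as [T HT].
    destruct (vanishing_initial E Hdec Hemp T) as [n Hn].
    exists n. apply Hs; [linf|]. eapply Rlt_le_trans; [apply HT|].
    apply (niv_mono I N); linf. intros t. unfold spaste.
    specialize (Hb t). specialize (Hn t). pose proof (Rabs_pos k).
    pose proof (Rle_abs (- k)). rewrite Rabs_Ropp in *.
    destruct (excluded_middle_informative (T <= t)%nat),
      (excluded_middle_informative (E n t)); try lra.
    exfalso. apply Hn; auto. lia.
  - intros x d Hx Hd H. apply Hrep in H; try now linf. apply Hrep; try now linf.
    apply Rle_ge, (cost_shift_consistent c I Hmin); auto. now apply Rge_le.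
Qed.

(** * Constant equivalents from the axioms *)

Section FromAxioms.
Context (pref : seqR -> seqR -> Prop)
  (W : WeakOrder pref) (Mon : Monotonicity pref) (Cont : Continuity pref)
  (Icrp : ICRP pref).

Let in_linf_cst (a : R) : in_linf (cst a) := in_linf_const a.
Hint Resolve in_linf_cst : core.

Lemma pref_trans (x y z : seqR) :
  in_linf x -> in_linf y -> in_linf z -> pref x y -> pref y z -> pref x z.
Proof. apply (proj2 W). Qed.

Lemma pref_cst_le (a b : R) : b <= a -> pref (cst a) (cst b).
Proof. intros H. apply (proj1 Mon); auto. intros t. unfold cst. lra. Qed.

(** If [a < b], translating and chaining makes 0 weakly preferred to every multiple of [b - a],
    hence to 1, against monotonicity. *)
Lemma pref_cst_inv (a b : R) : pref (cst a) (cst b) -> b <= a.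
Proof.
  intros H. apply Rnot_lt_le. intros Hab.
  assert (Hn : forall n, pref (cst 0) (cst (INR n * (b - a)))).
  { induction n.
    - apply pref_cst_le. simpl. lra.
    - apply (pref_trans _ (cst (INR n * (b - a)))); auto.
      assert (H1 := Icrp _ _ (INR n * (b - a) - a) (in_linf_cst a)
                      (in_linf_cst b) H).
      change (pref (cst (a + (INR n * (b - a) - a)))
                   (cst (b + (INR n * (b - a) - a)))) in H1.
      rewrite S_INR.
      replace (INR n * (b - a)) with (a + (INR n * (b - a) - a)) at 1 by ring.
      replace ((INR n + 1) * (b - a)) with (b + (INR n * (b - a) - a)) by ring.
      exact H1. }
  destruct (INR_unbounded (/ (b - a))) as [n Hub].
  apply (proj2 (proj2 Mon)).
  apply (pref_trans _ (cst (INR n * (b - a)))); auto.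
  apply pref_cst_le.
  assert (1 = / (b - a) * (b - a)) by (field; lra). nra.
Qed.

(** The value is the supremum [m] of the constants to which [x] is weakly preferred. Continuity
    along mixtures of [B] and [- B] carries both preferences to [m], from constants near [m] on each
    side. *)
Lemma certainty_equivalent (x : seqR) :
  in_linf x -> exists v, indiff pref x (cst v).
Proof.
  intros Hx. destruct (in_linf_bound x Hx) as [B [HB Hb]].
  assert (HxB : pref (cst B) x).
  { apply (proj1 Mon); auto. intros t. apply Rle_ge, Hb. }
  assert (HBx : pref x (cst (- B))).
  { apply (proj1 Mon); auto. intros t. apply Rle_ge, Hb. }
  destruct (completeness (fun a => pref x (cst a))) as [m [Hub Hlub]].
  { exists B. intros a Ha. apply pref_cst_inv.
    now apply (pref_trans _ x). }
  { now exists (- B). }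
  assert (Hm : - B <= m <= B).
  { split; [now apply Hub|]. apply Hlub. intros a Ha. apply pref_cst_inv.
    now apply (pref_trans _ x). }
  destruct (Cont (cst B) x (cst (- B))) as [C1 C2]; auto.
  (* The mixing weight that produces the constant [a]. *)
  set (w := fun a => (a + B) / (2 * B)).
  assert (Hw : forall a, smix (w a) (cst B) (cst (- B)) = cst a).
  { intros a. change (cst (w a * B + (1 - w a) * - B) = cst a). f_equal.
    unfold w. field. lra. }
  assert (Hw01 : forall a, - B <= a <= B -> 0 <= w a <= 1).
  { intros a Ha. unfold w. split; [apply Rdiv_le_0_compat; lra|].
    apply (Rmult_le_reg_r (2 * B)); [lra|]. unfold Rdiv.
    rewrite Rmult_assoc, Rinv_l; lra. }
  assert (Hwd : forall eta a, Rabs (a - m) < eta * (2 * B) -> Rabs (w a - w m) < eta).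
  { intros eta a Ha. apply (Rmult_lt_reg_r (2 * B)); [lra|].
    rewrite <- (Rabs_pos_eq (2 * B)) at 1 by lra. rewrite <- Rabs_mult.
    replace ((w a - w m) * (2 * B)) with (a - m) by (unfold w; field; lra). auto. }
  exists m. rewrite <- (Hw m). split.
  - refine (proj2 (C2 (w m) _)). intros [eta He].
    assert (0 < eta * (2 * B)) by (apply Rmult_lt_0_compat; [apply cond_pos|lra]).
    assert (exists a, pref x (cst a) /\ m - eta * (2 * B) < a) as [a [Ha Hma]].
    { apply NNPP. intros Hn. assert (m <= m - eta * (2 * B)); [|lra].
      apply Hlub. intros a Ha. apply Rnot_lt_le. intros Hlt. apply Hn. eauto. }
    assert (exists a', pref x (cst a') /\ m - eta * (2 * B) < a' /\ - B <= a')
      as [a' [Ha' [Hma' HBa']]].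
    { destruct (Rle_dec (- B) a); [now exists a|]. exists (- B).
      repeat split; auto; lra. }
    pose proof (Hub a' Ha').
    apply (He (w a')).
    + apply Hwd. split_Rabs; lra.
    + rewrite Hw. split; auto. apply Hw01. lra.
  - destruct (Req_dec m B) as [->|Hne]; [now rewrite Hw|].
    refine (proj2 (C1 (w m) _)). intros [eta He].
    assert (0 < eta * (2 * B)) by (apply Rmult_lt_0_compat; [apply cond_pos|lra]).
    (* The constant [m + h] exceeds the supremum, so completeness of the order makes it weakly
       preferred to [x]. *)
    set (h := Rmin (B - m) (eta * (2 * B) / 2)).
    assert (0 < h) by (apply Rmin_glb_lt; lra).
    assert (h <= B - m) by apply Rmin_l.
    assert (h <= eta * (2 * B) / 2) by apply Rmin_r.
    apply (He (w (m + h))).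
    + apply Hwd. split_Rabs; lra.
    + rewrite Hw. split; [apply Hw01; lra|].
      destruct (proj1 W x (cst (m + h)) Hx (in_linf_cst _)) as [H3|]; auto.
      apply Hub in H3. lra.
Qed.

Lemma exists_const_equiv : exists I, ConstEquiv pref I.
Proof.
  exists (fun x => epsilon (inhabits 0) (fun v => indiff pref x (cst v))).
  assert (Hce : forall x, in_linf x -> indiff pref x
    (cst (epsilon (inhabits 0) (fun v => indiff pref x (cst v))))).
  { intros x Hx. apply epsilon_spec. now apply certainty_equivalent. }
  split; auto. intros x y Hx Hy.
  destruct (Hce x Hx) as [X1 X2]. destruct (Hce y Hy) as [Y1 Y2].
  set (a := epsilon _ _) in X1, X2 |- *. set (b := epsilon _ _) in Y1, Y2 |- *.
  split; intros H.
  - apply Rle_ge, pref_cst_inv. apply (pref_trans _ x); auto.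
    now apply (pref_trans _ y).
  - apply (pref_trans _ (cst a)); auto. apply (pref_trans _ (cst b)); auto.
    apply pref_cst_le. lra.
Qed.

End FromAxioms.

(** * From the axioms to the representation *)

Lemma axioms_cost (pref : seqR -> seqR -> Prop) :
  WeakOrder pref -> Monotonicity pref -> Continuity pref -> ICRP pref ->
  Convexity pref -> MonotoneContinuity pref -> IDIS pref ->
  exists c I, grounded01 c /\ lsc01 c /\ c 1 = p_infty /\
    (forall x, in_linf x -> is_min_obj c x (I x)) /\ ConstEquiv pref I.
Proof.
  intros W Mon Cont Icrp Conv MC Id.
  destruct (exists_const_equiv pref W Mon Cont Icrp) as [I [Hce Hrep]].
  assert (Lc : forall a, in_linf (cst a)) by (intros; linf).
  assert (Iuniq : forall x a, in_linf x -> indiff pref x (cst a) -> I x = a).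
  { intros x a Hx [H1 H2]. destruct (Hce x Hx) as [H3 H4].
    apply Rle_antisym; apply (pref_cst_inv pref W Mon Icrp);
      now apply (pref_trans pref W _ x). }
  assert (Ic : forall a, I (cst a) = a).
  { intros a. apply Iuniq; auto. split; apply pref_cst_le; auto; lra. }
  assert (Imono : forall x y, in_linf x -> in_linf y ->
            (forall t, x t <= y t) -> I x <= I y).
  { intros x y Hx Hy H. apply Rge_le, Hrep; auto. apply (proj1 Mon); auto.
    intros t. apply Rle_ge, H. }
  assert (Iconst : forall x th, in_linf x -> I (fun t => x t + th) = I x + th).
  { intros x th Hx. apply Iuniq; [linf|].
    destruct (Hce x Hx) as [H1 H2].
    split; [apply (Icrp x (cst (I x)))|apply (Icrp (cst (I x)) x)]; auto. }
  assert (N : concave_niveloid I).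
  { split; auto. intros x y l Hx Hy Hl.
    (* Translating [y] to the level of [x] lets Convexity apply at the threshold [I x]; undoing the
       translation turns quasiconcavity into concavity. *)
    set (y' := fun t => y t + (I x - I y)).
    assert (Hy' : in_linf y') by (unfold y'; linf).
    assert (Iy' : I y' = I x) by (unfold y'; rewrite Iconst by auto; ring).
    assert (H : pref (smix l x y') (cst (I x))).
    { apply Conv; auto; apply Hrep; auto; rewrite Ic; lra. }
    apply Hrep in H; auto; [|linf]. rewrite Ic in H.
    assert (I (smix l x y') <=
            I (fun t => l * x t + (1 - l) * y t) + (1 - l) * (I x - I y)).
    { rewrite <- Iconst by linf. apply Imono; linf.
      intros t. unfold y'. lra. }
    lra. }
  assert (Hs : forall x a, in_linf x -> (spref pref x (cst a) <-> a < I x)).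
  { intros x a Hx. unfold spref. rewrite !Hrep, Ic by auto. lra. }
  destruct (variational_representation I) as [c [G [L [c1 Hmin]]]]; auto.
  - intros x d Hx Hd H. apply Rge_le.
    apply (Hrep (sadd x (shift0 d)) x); try now linf.
    apply Id; auto. apply Hrep; try now linf. now apply Rle_ge.
  - intros x th k Hx H. apply Hs in H; auto.
    destruct (MC x th (fun n t => (n <= t)%nat) Hx H) with (k := k) as [n Hn].
    + intros n t. lia.
    + intros t Ht. specialize (Ht (S t)). lia.
    + exists n. apply Hs in Hn; [exact Hn|linf].
  - exists c, I. exact (conj G (conj L (conj c1 (conj Hmin (conj Hce Hrep))))).
Qed.

Theorem theorem1 (pref : seqR -> seqR -> Prop) :
  (WeakOrder pref /\ Monotonicity pref /\ Continuity pref /\ ICRP pref /\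
   Convexity pref /\ MonotoneContinuity pref /\ IDIS pref)
  <->
  (exists c : R -> Rbar,
     grounded01 c /\ lsc01 c /\ c 1 = p_infty /\
     exists I : seqR -> R,
       (forall x, in_linf x -> is_min_obj c x (I x)) /\
       ConstEquiv pref I).
Proof.
  split.
  - intros [W [Mon [Cont [Icrp [Conv [MC Id]]]]]].
    destruct (axioms_cost pref) as [c [I [G [L [c1 [Hmin Hce]]]]]]; auto.
    exists c. split; [|split; [|split]]; auto. now exists I.
  - intros [c [_ [L [c1 [I [Hmin Hce]]]]]]. now apply (cost_axioms pref c I).
Qed.
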